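(* Let $X$ be a nonempty compact metric space. Given any $\sigma$-compact family $\mathcal{F}\subseteq\mathcal{C}(X,X)$, there exists a continuous map $U_{\mathcal{F}}:2^{\mathbb{N}}\to 2^{\mathbb{N}}$ such that every $T\in\mathcal{F}$ is a generalized factor of $U_{\mathcal{F}}$.
   Context: $\mathcal{C}(X,X)$ is the space of continuous maps from $X$ to $X$ with the topology of uniform convergence; a family is $\sigma$-compact if it is a countable union of compact sets. $2^{\mathbb{N}}$ is the Cantor space. For a compact metric space $X$, $\mathcal{K}(X)$ is the space of all nonempty compact subsets of $X$ with the Hausdorff metric, and a continuous $T:X\to X$ induces $T:\mathcal{K}(X)\to\mathcal{K}(X)$ by $T(M)=\{T(x): x\in M\}$. A continuous self-map $T:X\to X$ is a generalized factor of a continuous self-map $S:E\to E$ if there exists an upper semicontinuous mapping $\pi:E\to\mathcal{K}(X)$ such that $\{x\}\in\pi(E)$ for every $x\in X$, and $\pi(S(u))=T(\pi(u))$ for all $u\in E$. Here $\pi$ is upper semicontinuous if for every open $O\subseteq X$ the set $\{u\in E:\pi(u)\subseteq O\}$ is open in $E$ (equivalently, the relation $x\in\pi(u)$ is closed in $E\times X$). *)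

(* Defs.v *)
From HB Require Import structures.
From mathcomp Require Import all_boot all_order all_algebra.
From mathcomp Require Import all_classical all_reals all_analysis.

Set Implicit Arguments.
Unset Strict Implicit.
Unset Printing Implicit Defensive.

Local Open Scope classical_set_scope.

Definition sigma_compact (T : topologicalType) (A : set T) : Prop :=
  exists2 K : nat -> set T,
    (forall n, compact (K n)) & A = \bigcup_n K n.

(* The nonempty compact subsets of X. Only the underlying set of the space
   K(X) is needed: upper semicontinuity of a K(X)-valued map refers to the
   topology of X and not to the Hausdorff metric. *)
Record hyperspace (X : topologicalType) := Hyperspace {
  hset :> set X;
  hset_nonempty : hset !=set0;
  hset_compact : compact hset
}.

Arguments hset_nonempty {X} _.
Arguments hset_compact {X} _.

Lemma hyperspaceP (X : topologicalType) (M N : hyperspace X) :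
  M = N <-> hset M = hset N.
Proof.
split=> [->//|]; case: M N => [M M0 cM] [N N0 cN] /= MN.
by subst N; congr Hyperspace; exact: Prop_irrelevance.
Qed.

Lemma image_hyperspace_nonempty (X Y : topologicalType)
  (T : continuousType X Y) (M : hyperspace X) : T @` M !=set0.
Proof. by have [x Mx] := hset_nonempty M; exists (T x); exists x. Qed.

Lemma image_hyperspace_compact (X Y : topologicalType)
  (T : continuousType X Y) (M : hyperspace X) : compact (T @` M).
Proof.
apply: continuous_compact; last exact: hset_compact.
exact/continuous_subspaceT/cts_fun.
Qed.

Arguments image_hyperspace_nonempty {X Y} T M.
Arguments image_hyperspace_compact {X Y} T M.

Definition hyperspace_map (X Y : topologicalType) (T : continuousType X Y)
    (M : hyperspace X) : hyperspace Y :=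
  Hyperspace (image_hyperspace_nonempty T M) (image_hyperspace_compact T M).

Definition upper_semicontinuous (E X : topologicalType)
    (p : E -> hyperspace X) : Prop :=
  forall O : set X, open O -> open [set u | p u `<=` O].

Definition generalized_factor (X E : topologicalType)
    (T : continuousType X X) (S : continuousType E E) : Prop :=
  exists p : E -> hyperspace X,
    [/\ upper_semicontinuous p,
        (forall x : X, exists u : E, hset (p u) = [set x]) &
        (forall u : E, p (S u) = hyperspace_map T (p u))].

(* Main.v *)
From HB Require Import structures.
Require Import Defs.
From mathcomp Require Import all_boot all_order all_algebra.
From mathcomp Require Import all_classical all_reals all_analysis.

(* Puts the topology of uniform convergence on [continuousType X X]. *)
Import ArrowAsUniformType.

Local Open Scope classical_set_scope.

(** A single map works for every compact metric space and every continuous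
self-map of it: the injection u |-> 1u of the Cantor space, which prepends the
letter 1. Write every infinite word as either 1^n 0 w or the constant word 1^oo.
Prepending 1 increases n by one and leaves w alone, so, apart from its fixed
point 1^oo, the system is a disjoint union of forward orbits, one starting at
each word 0w, and these orbits all converge to 1^oo. Given a continuous
surjection g from the Cantor space onto X (Alexandroff-Hausdorff) and
T : X -> X, put

  p(1^n 0 w) = {T^n (g w)},     p(1^oo) = K, the intersection of all T^n(X).

The words 0w give all the singletons of X, since g is onto. Equivariance holds
on each orbit by construction, and at 1^oo it says that T(K) = K
([image_core]), a consequence of compactness. Upper semicontinuity at a word
1^n 0 w is continuity of T^n and g, as nearby words have the same prefix 1^n 0.
At 1^oo it holds because an open set containing K contains some T^N(X), by
compactness again ([compact_nonincreasing_bigcap_subset]), and a word close to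
1^oo starts with N letters 1, so that its value lies in T^N(X). *)

Lemma compact_nonincreasing_bigcap_neq0 (X : topologicalType)
    (K : nat -> set X) :
  compact [set: X] -> (forall n, closed (K n)) ->
  (forall m n, (m <= n)%N -> K n `<=` K m) ->
  (forall n, K n !=set0) -> \bigcap_n K n !=set0.
Proof.
move=> cX clK decK K0.
have FK : ProperFilter (filter_from [set: nat] K).
  apply: filter_from_proper => [|n _]; last exact: K0.
  apply: filter_from_filter => [|m n _ _]; first by exists 0%N.
  exists (maxn m n) => // x Kx.
  by split; apply: decK Kx; rewrite ?leq_maxl ?leq_maxr.
have [|p [_ clp]] := cX _ FK; first by exists 0%N.
exists p => n _; apply: clK => B Bp.
by apply: clp Bp; exists n.
Qed.

(** Otherwise the sets K n minus O would be nonempty, closed and nonincreasing,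
hence would have a common point. *)
Lemma compact_nonincreasing_bigcap_subset (X : topologicalType)
    (K : nat -> set X) (O : set X) :
  compact [set: X] -> (forall n, closed (K n)) ->
  (forall m n, (m <= n)%N -> K n `<=` K m) ->
  open O -> \bigcap_n K n `<=` O -> exists n, K n `<=` O.
Proof.
move=> cX clK decK oO KO; apply: contrapT => /forallNP nKO.
have [||||x Kx] := @compact_nonincreasing_bigcap_neq0 X (fun n => K n `\` O).
- exact: cX.
- by move=> n; apply: closedI; [exact: clK|exact: open_closedC].
- by move=> m n mn x [Kx nOx]; split => //; exact: decK mn _ Kx.
- move=> n; apply: contrapT => /forallNP KO0; apply: (nKO n) => x Kx.
  by apply: contrapT => nOx; apply: (KO0 x).
- have [_] := Kx 0%N I; apply.
  by apply: KO => n _; have [] := Kx n I.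
Qed.

Lemma continuous_cantor (T : topologicalType) (f : T -> cantor_space) :
  (forall i, continuous (fun x => f x i)) -> continuous f.
Proof.
move=> cf x; apply/cvg_sup => i; apply/cvg_image.
  by apply/seteqP; split => // b _; exists (fun=> b).
move=> U /(cf i x) fU; exists ((fun u : cantor_space => u i) @^-1` U) => //.
by rewrite image_preimage //; apply/seteqP; split => // b _; exists (fun=> b).
Qed.

Lemma continuous_coord (i : nat) : continuous (fun u : cantor_space => u i).
Proof. exact: (@proj_continuous nat (fun=> bool) i). Qed.

Lemma nbhs_cylinder (u : cantor_space) (n : nat) :
  nbhs u [set v | forall i, (i < n)%N -> v i = u i].
Proof.
elim: n => [|n IHn]; first exact: filterS filterT.
have := continuous_coord n u _ (discrete_set1 (u n)).
move/(filterI IHn); apply: filterS => v [/= vn vun] i.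
by rewrite ltnS leq_eqVlt => /predU1P[->//|]; exact: vn.
Qed.

Definition cantor_cons (b : bool) (u : cantor_space) : cantor_space :=
  fun i => if i is j.+1 then u j else b.

Lemma cantor_cons_continuous b : continuous (cantor_cons b).
Proof.
apply: continuous_cantor => -[|i]; first exact: cst_continuous.
exact: continuous_coord.
Qed.

HB.instance Definition _ b :=
  isContinuous.Build cantor_space cantor_space (cantor_cons b)
    (@cantor_cons_continuous b).

Definition cantor_drop (n : nat) (u : cantor_space) : cantor_space :=
  fun i => u (n + i)%N.

Lemma cantor_drop_continuous n : continuous (cantor_drop n).
Proof. by apply: continuous_cantor => i; exact: continuous_coord. Qed.

Lemma cantor_first_false (u : cantor_space) :
  (forall i, u i) \/
  (exists n, (forall i, (i < n)%N -> u i) /\ ~~ u n).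
Proof.
have [exu|/forallNP u1] := pselect (exists n, ~~ u n); last first.
  by left=> i; apply: contrapT => /negP; exact: u1.
right; case: (ex_minnP exu) => m um mmin; exists m; split => //.
by move=> i im; apply: contraLR im => /mmin; rewrite -leqNgt.
Qed.

Section prefix_factor.
Context (X : topologicalType) (cX : compact [set: X]) (hX : hausdorff_space X).
Context (g : cantor_space -> X) (cg : continuous g).
Context (sg : forall x, exists u, g u = x).
Context (T : continuousType X X).

Definition iter_range (n : nat) : set X := iter n T @` [set: X].

Lemma iter_continuous n : continuous (iter n T).
Proof.
elim: n => [x//|n IHn x].
exact: (@continuous_comp _ _ _ (iter n T) T x (IHn x) (cts_fun _)).
Qed.

Lemma iter_range_closed n : closed (iter_range n).
Proof.
apply: compact_closed => //; apply: continuous_compact => //.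
exact/continuous_subspaceT/iter_continuous.
Qed.

Lemma iter_range_nonincreasing m n :
  (m <= n)%N -> iter_range n `<=` iter_range m.
Proof.
move=> mn _ [x _ <-]; exists (iter (n - m) T x) => //.
by rewrite -iterD subnKC.
Qed.

Lemma image_iter_range n : T @` iter_range n = iter_range n.+1.
Proof.
by rewrite /iter_range image_comp; congr (_ @` _); apply/funext.
Qed.

Lemma core_nonempty : \bigcap_n iter_range n !=set0.
Proof.
apply: compact_nonincreasing_bigcap_neq0 => //.
- exact: iter_range_closed.
- exact: iter_range_nonincreasing.
- by move=> n; exists (iter n T (g (fun=> true))); exists (g (fun=> true)).
Qed.

(** For the inclusion of the right-hand side in the left-hand side, a point y of
the intersection has a preimage in every [iter_range n]; the sets of these
preimages are closed and nonincreasing, so y has one preimage in all of them. *)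
Lemma image_core :
  T @` (\bigcap_n iter_range n) = \bigcap_n iter_range n.
Proof.
apply/seteqP; split => [_ [x xK <-] n _|y yK].
  apply: (iter_range_nonincreasing _ _ (leqnSn n)).
  by rewrite -image_iter_range; exists x => //; exact: xK.
have [||||x xK] :=
  @compact_nonincreasing_bigcap_neq0 X
    (fun n => iter_range n `&` T @^-1` [set y]).
- exact: cX.
- move=> n; apply: closedI; first exact: iter_range_closed.
  apply: closed_comp => [x _|]; first exact: cts_fun.
  by apply: compact_closed => //; exact: compact_set1.
- move=> m n mn x [xn Txy]; split => //.
  exact: iter_range_nonincreasing mn _ xn.
- move=> n; have := yK n.+1 I; rewrite -image_iter_range => -[x xn Txy].
  by exists x.
- by exists x => [n _|]; [have [] := xK n I|have [] := xK 0%N I].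
Qed.

(** The map p of the introduction, without a case distinction on whether u
contains the letter 0: if u = 1^n 0 w, the indices that occur are 0, ..., n, and
the term of index n is the point T^n (g w), which lies in the ranges of T^k for
k < n contributed by the other indices; if u = 1^oo, all the ranges occur. *)
Definition decode (u : cantor_space) : set X :=
  \bigcap_(n in [set n | forall i, (i < n)%N -> u i])
    (iter n T @` if u n then [set: X] else [set g (cantor_drop n.+1 u)]).

Lemma decode_ones (u : cantor_space) :
  (forall i, u i) -> decode u = \bigcap_n iter_range n.
Proof.
move=> u1; apply/seteqP; split => x xK n.
  by move=> _; have := xK n (fun i _ => u1 i); rewrite u1.
by move=> _; rewrite u1; exact: xK.
Qed.

Lemma decode_first_false (u : cantor_space) (n : nat) :
  (forall i, (i < n)%N -> u i) -> ~~ u n ->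
  decode u = [set iter n T (g (cantor_drop n.+1 u))].
Proof.
move=> u1 un; apply/seteqP; split => [x /(_ n u1)|_ -> m um].
  by rewrite (negbTE un) image_set1.
have [mn|nm|->] := ltngtP m n.
- by rewrite u1 //; apply: iter_range_nonincreasing (ltnW mn) _ _; eexists.
- by have := um n nm; rewrite (negbTE un).
- by rewrite (negbTE un); exists (g (cantor_drop n.+1 u)).
Qed.

Lemma decode_nonempty (u : cantor_space) : decode u !=set0.
Proof.
have [u1|[n [u1 un]]] := cantor_first_false u.
  by rewrite decode_ones //; exact: core_nonempty.
by rewrite (decode_first_false u n) //; eexists.
Qed.

Lemma decode_compact (u : cantor_space) : compact (decode u).
Proof.
have [u1|[n [u1 un]]] := cantor_first_false u.
  rewrite decode_ones //; apply: subclosed_compact cX _ => //.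
  by apply: closed_bigI => n _; exact: iter_range_closed.
by rewrite (decode_first_false u n) //; exact: compact_set1.
Qed.

Lemma decode_subset_iter_range (u : cantor_space) (n : nat) :
  (forall i, (i < n)%N -> u i) -> decode u `<=` iter_range n.
Proof. by move=> u1 x /(_ n u1)[y _ <-]; exists y. Qed.

Lemma decode_cons_true (u : cantor_space) :
  decode (cantor_cons true u) = T @` decode u.
Proof.
have [u1|[n [u1 un]]] := cantor_first_false u.
  have cu1 i : cantor_cons true u i by case: i => [|i] //=; exact: u1.
  by rewrite (decode_ones _ cu1) (decode_ones _ u1) image_core.
rewrite (decode_first_false u n) // image_set1.
by rewrite (decode_first_false _ n.+1) // => -[|i] //; exact: u1.
Qed.

Lemma decode_cons_false (u : cantor_space) :
  decode (cantor_cons false u) = [set g u].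
Proof. by rewrite (decode_first_false _ 0). Qed.

(** Near the constant word 1 the values shrink into O because the ranges of the
iterates do; elsewhere [decode] is locally a continuous point-valued map. *)
Lemma decode_usc (O : set X) : open O -> open [set u | decode u `<=` O].
Proof.
move=> oO; rewrite openE => u; rewrite /= /interior.
have [u1|[n [u1 un]]] := cantor_first_false u.
  rewrite decode_ones // => KO.
  have [n nO] := compact_nonincreasing_bigcap_subset _ _ _ cX
    iter_range_closed iter_range_nonincreasing oO KO.
  apply: filterS (nbhs_cylinder u n) => v vu.
  apply: subset_trans nO; apply: decode_subset_iter_range => i /vu ->.
  exact: u1.
rewrite (decode_first_false u n) // => uO.
pose h v := iter n T (g (cantor_drop n.+1 v)).
have ch : continuous h.
  move=> v; apply: (@continuous_comp _ _ _ (g \o cantor_drop n.+1)).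
    by apply: continuous_comp; [exact: cantor_drop_continuous|exact: cg].
  exact: iter_continuous.
have hO : nbhs u (h @^-1` O).
  by apply: ch; apply: open_nbhs_nbhs; split => //; exact: uO.
apply: filterS (filterI hO (nbhs_cylinder u n.+1)) => v [vO vu] /=.
rewrite (decode_first_false v n) => [_ ->//|i i_n|]; last by rewrite vu.
by rewrite vu ?u1// ltnS ltnW.
Qed.

Lemma generalized_factor_cantor_cons :
  generalized_factor T
    (cantor_cons true : continuousType cantor_space cantor_space).
Proof.
exists (fun u => Hyperspace (decode_nonempty u) (decode_compact u)); split.
- exact: decode_usc.
- move=> x; have [u <-] := sg x; exists (cantor_cons false u).
  exact: decode_cons_false.
- by move=> u; apply/hyperspaceP; exact: decode_cons_true.
Qed.

End prefix_factor.

(** The Alexandroff-Hausdorff theorem is stated for pointed spaces, whence the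
auxiliary pointed structure on X. *)
Lemma compact_metric_cantor_image (R : realType) (X : metricType R) :
  [set: X] !=set0 -> compact [set: X] ->
  exists2 g : cantor_space -> X, continuous g & forall x, exists u, g u = x.
Proof.
move=> [x0 _] cX.
pose X' : pseudoPMetricType R :=
  HB.pack_for (pseudoPMetricType R) X (isPointed.Build X x0).
have [g cg] := @cantor_surj R X' cX (@metric_hausdorff R X).
exists g => // x; have [u _ <-] := @surj _ _ _ _ g x I.
by exists u.
Qed.

Theorem theorem5p2 (R : realType) (X : metricType R)
    (hX0 : [set: X] !=set0) (hXc : compact [set: X])
    (F : set (continuousType X X)) (hF : sigma_compact F) :
  exists U : continuousType cantor_space cantor_space,
    forall T : continuousType X X, F T -> generalized_factor T U.
Proof.
have [g cg sg] := compact_metric_cantor_image R X hX0 hXc.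
exists (cantor_cons true) => T _.
exact: generalized_factor_cantor_cons hXc (@metric_hausdorff R X) g cg sg T.
Qed.
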